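(* Let $n\ge0$ and let $w_1,w_2\in\mathbb{N}$ with $w_1\equiv1\pmod 2$ and $w_2\equiv1\pmod2$. Then, for all $x$ (as an identity of polynomials in $x$), \[ \sum_{l=0}^{n}(-4)^{n-l}C_{l,w_1}(w_2x)\,S_{n-l,w_2}(w_1-1)=\sum_{l=0}^{n}(-4)^{n-l}C_{l,w_2}(w_1x)\,S_{n-l,w_1}(w_2-1). \]
   Context: For $w\in\mathbb{N}$, the $w$-Catalan polynomials $C_{n,w}(x)$ are defined by the generating function \[ \frac{2}{1+(1-4t)^{w/2}}(1-4t)^{\frac{w}{2}x}=\sum_{n\ge0}C_{n,w}(x)t^n, \] where $(1-4t)^{a}=\sum_{k\ge0}\binom{a}{k}(-4t)^k$ and $\binom{a}{k}=\frac{a(a-1)\cdots(a-k+1)}{k!}$. For integers $k\ge0$ and $d,w\in\mathbb{N}$ odd, define \[ S_{k,d}(w-1)=\sum_{i=0}^{w-1}\binom{\frac{di}{2}}{k}(-1)^i. \] *)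

(* Defs.v *)
From mathcomp Require Import all_boot all_order all_algebra.

Set Implicit Arguments.
Unset Strict Implicit.
Unset Printing Implicit Defensive.

Import GRing.Theory.
Local Open Scope ring_scope.

Section FormalPowerSeries.
Variable R : comUnitRingType.

(* A formal power series is its coefficient sequence: f stands for            *)
(* \sum_n (f n) t^n.                                                          *)
Definition fps := nat -> R.

Implicit Types (f g : fps) (a c : R) (n k : nat).

Definition fps_const c : fps := fun n => if n == 0%N then c else 0.

Definition fps_add f g : fps := fun n => f n + g n.

Definition fps_mul f g : fps := fun n => \sum_(i < n.+1) f i * g (n - i)%N.

(* The coefficients 0, ..., n of 1 / f, computed from left to right. *)
Fixpoint fps_inv_seq f n : seq R :=
  if n is m.+1 then
    let s := fps_inv_seq f m in
    rcons s (- (f 0%N)^-1 * \sum_(i < n) f (n - i)%N * s`_i)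
  else [:: (f 0%N)^-1].

(* Meaningful when f 0 is a unit, see fps_mulfV. *)
Definition fps_inv f : fps := fun n => (fps_inv_seq f n)`_n.

Definition fps_div f g : fps := fps_mul f (fps_inv g).

(* a (a - 1) ... (a - k + 1) / k!, meaningful when k! is a unit of R. *)
Definition gbinom a k : R := (\prod_(i < k) (a - i%:R)) / (k`!)%:R.

(* (1 - 4t)^a *)
Definition pow_1m4t a : fps := fun k => gbinom a k * (- 4%:R) ^+ k.

Lemma size_fps_inv_seq f n : size (fps_inv_seq f n) = n.+1.
Proof. by elim: n => //= n IHn; rewrite size_rcons IHn. Qed.

Lemma nth_fps_inv_seq f n i : (i <= n)%N -> (fps_inv_seq f n)`_i = fps_inv f i.
Proof.
elim: n => [|n IHn]; first by rewrite leqn0 => /eqP ->.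
rewrite leq_eqVlt => /orP[/eqP -> //|lt_in].
by rewrite /= nth_rcons size_fps_inv_seq lt_in IHn.
Qed.

Lemma fps_invS f n :
  fps_inv f n.+1 =
  - (f 0%N)^-1 * \sum_(i < n.+1) f (n.+1 - i)%N * fps_inv f i.
Proof.
rewrite {1}/fps_inv /= nth_rcons size_fps_inv_seq ltnn eqxx.
by congr (_ * _); apply: eq_bigr => i _; rewrite nth_fps_inv_seq // -ltnS.
Qed.

Lemma fps_mulVf f : f 0%N \is a GRing.unit ->
  fps_mul (fps_inv f) f =1 fps_const 1.
Proof.
move=> Uf [|n]; rewrite /fps_mul /fps_const /=.
  by rewrite big_ord1 mulVr.
rewrite big_ord_recr /= subnn fps_invS mulNr mulNr mulrAC mulVr // mul1r.
by apply/eqP; rewrite subr_eq0; apply/eqP/eq_bigr => i _; rewrite mulrC.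
Qed.

Lemma fps_mulC f g : fps_mul f g =1 fps_mul g f.
Proof.
move=> n; rewrite /fps_mul (reindex_inj rev_ord_inj) /=; apply: eq_bigr => i _.
by rewrite subSS mulrC subKn // -ltnS.
Qed.

Lemma fps_mulfV f : f 0%N \is a GRing.unit ->
  fps_mul f (fps_inv f) =1 fps_const 1.
Proof. by move=> Uf n; rewrite fps_mulC fps_mulVf. Qed.

End FormalPowerSeries.

(* 2 / (1 + (1 - 4t)^(w/2)) * (1 - 4t)^(w x / 2), with x the variable 'X of   *)
(* the coefficient ring {poly rat}.                                           *)
Definition catalan_gf (w : nat) : fps {poly rat} :=
  fps_mul
    (fps_div (fps_const 2%:R)
       (fps_add (fps_const 1) (pow_1m4t ((w%:R / 2%:R : rat)%:P))))
    (pow_1m4t ((w%:R / 2%:R : rat)%:P * 'X)).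

(* C_{n,w}(x) *)
Definition catalan_poly (n w : nat) : {poly rat} := catalan_gf w n.

(* S_{k,d}(m); note that the sum has m + 1 terms. *)
Definition alt_binom_sum (k d m : nat) : rat :=
  \sum_(0 <= i < m.+1) gbinom ((d * i)%:R / 2%:R : rat) k * (-1) ^+ i.

(* The constant term of the denominator of catalan_gf is invertible. *)
Lemma catalan_denom_unit w :
  fps_add (fps_const 1) (pow_1m4t ((w%:R / 2%:R : rat)%:P)) 0%N
    \is a GRing.unit.
Proof.
rewrite /fps_add /fps_const /pow_1m4t /gbinom /= big_ord0 fact0 divr1 mulr1.
by rewrite -polyC1 -polyCD poly_unitE size_polyC coefC.
Qed.

(* Main.v *)
Require Import Defs.
From HB Require Import structures.
From mathcomp Require Import all_boot all_order all_algebra.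
From mathcomp Require Import ring.
From mathcomp Require Import boolp.

(** Put E(a) = (1 - 4t)^a.  Vandermonde's identity gives E(a + b) = E(a) E(b),
    so that the generating function of (-4)^k S_{k,d}(w-1) is the geometric sum
    of the powers (-E(d/2))^i, i < w; for w odd it equals
    (1 + E(dw/2)) / (1 + E(d/2)).  The generating function of C_{l,w}(dx) is
    2 E(dwx/2) / (1 + E(w/2)), and the product of the two is symmetric in d
    and w. *)

Set Implicit Arguments.
Unset Strict Implicit.
Unset Printing Implicit Defensive.

Import GRing.Theory Num.Theory.
Local Open Scope ring_scope.

Lemma mulr_sum_exprN_odd (R : pzRingType) (x : R) m : odd m ->
  (1 + x) * \sum_(i < m) (- x) ^+ i = 1 + x ^+ m.
Proof.
move=> odd_m; have := subrX1 (- x) m.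
rewrite exprNn -signr_odd odd_m mulN1r -!opprD mulNr => /oppr_inj.
by rewrite ![_ + 1]addrC.
Qed.

Section FpsRing.
Variable R : comUnitRingType.
Implicit Types f g h : fps R.

Definition fps_opp f : fps R := fun n => - f n.

Fact fps_addA : associative (@fps_add R).
Proof. by move=> f g h; apply/funext => n; apply: addrA. Qed.

Fact fps_addC : commutative (@fps_add R).
Proof. by move=> f g; apply/funext => n; apply: addrC. Qed.

Fact fps_add0 : left_id ((fun=> 0) : fps R) (@fps_add R).
Proof. by move=> f; apply/funext => n; apply: add0r. Qed.

Fact fps_addN : left_inverse ((fun=> 0) : fps R) fps_opp (@fps_add R).
Proof. by move=> f; apply/funext => n; apply: addNr. Qed.

HB.instance Definition _ := Choice.copy (fps R) (nat -> R).

HB.instance Definition _ :=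
  GRing.isZmodule.Build (fps R) fps_addA fps_addC fps_add0 fps_addN.

Lemma fps_mul_trunc f g n N : (n < N)%N ->
  fps_mul f g n = ((\poly_(i < N) f i) * (\poly_(i < N) g i))`_n.
Proof.
move=> lt_nN; rewrite coefM; apply: eq_bigr => i _; rewrite !coef_poly.
by rewrite (leq_ltn_trans (leq_subr _ _) lt_nN) (leq_trans (ltn_ord i)).
Qed.

Fact fps_mulA : associative (@fps_mul R).
Proof.
move=> f g h; apply/funext => n; pose trunc (u : fps R) := \poly_(i < n.+1) u i.
transitivity ((trunc f * trunc g * trunc h)`_n); last first.
  rewrite coefM; apply: eq_bigr => i _.
  by rewrite -fps_mul_trunc // coef_poly ltnS leq_subr.
rewrite -mulrA coefM; apply: eq_bigr => i _.
by rewrite -fps_mul_trunc ?ltnS ?leq_subr // coef_poly ltn_ord.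
Qed.

Fact fps_mul_comm : commutative (@fps_mul R).
Proof. by move=> f g; apply/funext/fps_mulC. Qed.

Fact fps_mul1 : left_id (fps_const 1) (@fps_mul R).
Proof.
move=> f; apply/funext => n; rewrite /fps_mul big_ord_recl mul1r subn0.
by rewrite big1 ?addr0 // => i _; rewrite mul0r.
Qed.

Fact fps_mulDl : left_distributive (@fps_mul R) +%R.
Proof.
move=> f g h; apply/funext => n; rewrite -[RHS]big_split.
by apply: eq_bigr => i _; rewrite mulrDl.
Qed.

Fact fps_one_neq0 : fps_const (1 : R) != 0.
Proof. by apply/eqP => /(congr1 (@^~ 0%N))/eqP; apply/negP/oner_neq0. Qed.

HB.instance Definition _ := GRing.Zmodule_isComNzRing.Build (fps R)
  fps_mulA fps_mul_comm fps_mul1 fps_mulDl fps_one_neq0.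

Lemma coef_fps_sum (I : Type) (r : seq I) (P : pred I) (F : I -> fps R) n :
  (\sum_(i <- r | P i) F i) n = \sum_(i <- r | P i) F i n.
Proof. by elim/big_rec2: _ => // i _ s _ <-. Qed.

Lemma coef0_fpsM f g : (f * g) 0%N = f 0%N * g 0%N.
Proof. exact: big_ord1. Qed.

Definition fps_unit : pred (fps R) := fun f => f 0%N \is a GRing.unit.

Definition fps_uinv f : fps R := if fps_unit f then fps_inv f else f.

Fact fps_mulV : {in fps_unit, left_inverse 1 fps_uinv *%R}.
Proof. by move=> f Uf; rewrite /fps_uinv ifT //; apply/funext/fps_mulVf. Qed.

Fact fps_unitP f g : g * f = 1 -> fps_unit f.
Proof.
move/(congr1 (@^~ 0%N)); rewrite coef0_fpsM => gf1.
by apply/unitrPr; exists (g 0%N); rewrite mulrC.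
Qed.

Fact fps_uinv_out : {in [predC fps_unit], fps_uinv =1 id}.
Proof. by move=> f /negPf nUf; rewrite /fps_uinv ifF. Qed.

HB.instance Definition _ := GRing.ComNzRing_hasMulInverse.Build (fps R)
  fps_mulV fps_unitP fps_uinv_out.

Lemma fps_unitE f : (f \is a GRing.unit) = (f 0%N \is a GRing.unit).
Proof. by []. Qed.

Lemma fps_divE f g : g \is a GRing.unit -> fps_div f g = f / g.
Proof. by move=> Ug; rewrite /GRing.inv /= /fps_uinv ifT. Qed.

Lemma coef_fps_constM c f n : (fps_const c * f) n = c * f n.
Proof.
rewrite [LHS]big_ord_recl subn0 big1 ?addr0 // => i _.
by rewrite [fps_const _ _]/= mul0r.
Qed.

Fact fps_const_zmod_morphism : zmod_morphism (@fps_const R).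
Proof. by move=> a b; apply/funext => -[|n] //; apply/esym/subr0. Qed.

Fact fps_const_monoid_morphism : monoid_morphism (@fps_const R).
Proof.
split=> // a b; apply/funext => n; rewrite coef_fps_constM.
by case: n => [|n] //; rewrite /fps_const mulr0.
Qed.

HB.instance Definition _ := GRing.isZmodMorphism.Build R (fps R)
  (@fps_const R) fps_const_zmod_morphism.
HB.instance Definition _ := GRing.isMonoidMorphism.Build R (fps R)
  (@fps_const R) fps_const_monoid_morphism.

Definition fps_rescale c f : fps R := fun n => f n * c ^+ n.

Fact fps_rescale_zmod_morphism c : zmod_morphism (fps_rescale c).
Proof. by move=> f g; apply/funext => n; apply: mulrBl. Qed.

Fact fps_rescale_monoid_morphism c : monoid_morphism (fps_rescale c).
Proof.
split=> [|f g]; apply/funext => n.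
  by case: n => [|n]; rewrite /fps_rescale ?mulr1 ?mul0r.
rewrite /fps_rescale mulr_suml; apply: eq_bigr => i _.
by rewrite mulrACA -exprD subnKC // -ltnS.
Qed.

HB.instance Definition _ c := GRing.isZmodMorphism.Build (fps R) (fps R)
  (fps_rescale c) (fps_rescale_zmod_morphism c).
HB.instance Definition _ c := GRing.isMonoidMorphism.Build (fps R) (fps R)
  (fps_rescale c) (fps_rescale_monoid_morphism c).

End FpsRing.

Section MapFps.
Variables (R S : comUnitRingType) (phi : {rmorphism R -> S}).

Definition map_fps (f : fps R) : fps S := phi \o f.

Fact map_fps_zmod_morphism : zmod_morphism map_fps.
Proof. by move=> f g; apply/funext => n; apply: rmorphB. Qed.

Fact map_fps_monoid_morphism : monoid_morphism map_fps.
Proof.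
split=> [|f g]; apply/funext => n.
  by case: n => [|n]; rewrite /map_fps /= ?rmorph1 ?rmorph0.
by rewrite /map_fps /= rmorph_sum; apply: eq_bigr => i _; rewrite rmorphM.
Qed.

HB.instance Definition _ := GRing.isZmodMorphism.Build (fps R) (fps S)
  map_fps map_fps_zmod_morphism.
HB.instance Definition _ := GRing.isMonoidMorphism.Build (fps R) (fps S)
  map_fps map_fps_monoid_morphism.

End MapFps.

Section BinomialSeries.
Variable R : comUnitRingType.
Hypothesis natS_unit : forall k, k.+1%:R \is a @GRing.unit R.
Implicit Types (a b : R) (k n : nat).

Lemma fact_unit k : k`!%:R \is a @GRing.unit R.
Proof. by rewrite -(prednK (fact_gt0 k)). Qed.

Lemma gbinom0 a : gbinom a 0 = 1.
Proof. by rewrite /gbinom big_ord0 fact0 divr1. Qed.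

Lemma gbinom0n k : gbinom (0 : R) k = (k == 0%N)%:R.
Proof.
by case: k => [|k]; rewrite ?gbinom0 // /gbinom big_ord_recl subr0 !mul0r.
Qed.

Lemma mulr_gbinomS a k : k.+1%:R * gbinom a k.+1 = (a - k%:R) * gbinom a k.
Proof.
rewrite /gbinom big_ord_recr /= factS natrM invrM ?natS_unit ?fact_unit //.
by rewrite [LHS]mulrC !mulrA divrK // [_ * (a - _)]mulrC.
Qed.

Lemma gbinom_Vandermonde a b n :
  gbinom (a + b) n = \sum_(i < n.+1) gbinom a i * gbinom b (n - i).
Proof.
elim: n => [|n IHn]; first by rewrite big_ord1 !gbinom0 mulr1.
(* n + 1 = i + (n + 1 - i); the two halves recombine through
   (a - i) + (b - (n - i)) = (a + b) - n. *)
apply: (mulrI (natS_unit n)); rewrite mulr_gbinomS IHn !mulr_sumr.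
have split_index (i : 'I_n.+2) : n.+1%:R * (gbinom a i * gbinom b (n.+1 - i)) =
    i%:R * gbinom a i * gbinom b (n.+1 - i) +
    gbinom a i * ((n.+1 - i)%:R * gbinom b (n.+1 - i)).
  have le_in : (i <= n.+1)%N by rewrite -ltnS.
  by rewrite natrB //; ring.
rewrite [RHS](eq_bigr _ (fun i _ => split_index i)) big_split /=.
rewrite [X in _ = X + _]big_ord_recl /= !mul0r add0r.
rewrite [X in _ = _ + X]big_ord_recr /= subnn mul0r mulr0 addr0 -big_split /=.
apply: eq_bigr => i _; have le_in : (i <= n)%N by rewrite -ltnS.
by rewrite subSS subSn // !mulr_gbinomS natrB //; ring.
Qed.

Lemma pow_1m4tE a : pow_1m4t a = fps_rescale (- 4%:R) (gbinom a).
Proof. by []. Qed.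

Lemma pow_1m4tD a b : pow_1m4t (a + b) = pow_1m4t a * pow_1m4t b.
Proof.
rewrite !pow_1m4tE -rmorphM; congr (fps_rescale _ _).
by apply/funext/gbinom_Vandermonde.
Qed.

Lemma pow_1m4t0 : pow_1m4t (0 : R) = 1.
Proof.
rewrite pow_1m4tE -(rmorph1 (fps_rescale (- 4%:R))); congr (fps_rescale _ _).
by apply/funext => -[|k]; rewrite gbinom0n.
Qed.

Lemma pow_1m4tMn a n : pow_1m4t (a *+ n) = pow_1m4t a ^+ n.
Proof.
by elim: n => [|n IHn]; rewrite ?pow_1m4t0 // mulrS exprS pow_1m4tD IHn.
Qed.

Section Morphism.
Variables (S : comUnitRingType) (phi : {rmorphism R -> S}).

Lemma rmorph_gbinom a k : phi (gbinom a k) = gbinom (phi a) k.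
Proof.
rewrite /gbinom rmorphM rmorphV ?fact_unit // rmorph_nat rmorph_prod.
by under eq_bigr do rewrite rmorphB rmorph_nat.
Qed.

Lemma map_pow_1m4t a : map_fps phi (pow_1m4t a) = pow_1m4t (phi a).
Proof.
apply/funext => k; rewrite [LHS]rmorphM rmorph_gbinom.
by rewrite rmorphXn rmorphN rmorph_nat.
Qed.

End Morphism.
End BinomialSeries.

Lemma natS_unit_field (F : numFieldType) k : k.+1%:R \is a @GRing.unit F.
Proof. by rewrite unitfE pnatr_eq0. Qed.

Lemma natS_unit_poly (F : numFieldType) k :
  k.+1%:R \is a @GRing.unit {poly F}.
Proof. by rewrite -polyC_natr rmorph_unit ?natS_unit_field. Qed.

Definition pow_half n : fps rat := pow_1m4t (n%:R / 2%:R).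

Lemma pow_halfM d i : pow_half (d * i) = pow_half d ^+ i.
Proof.
by rewrite /pow_half natrM mulrAC mulr_natr (pow_1m4tMn (@natS_unit_field rat)).
Qed.

Definition catalan_denom w : fps rat := 1 + pow_half w.

Definition catalan_num w : fps {poly rat} :=
  2%:R * pow_1m4t ((w%:R / 2%:R)%:P * 'X).

Definition alt_binom_gf d m : fps rat :=
  fun k => (- 4%:R) ^+ k * alt_binom_sum k d m.

Lemma alt_binom_gfE d m :
  alt_binom_gf d m = \sum_(i < m.+1) (- pow_half d) ^+ i.
Proof.
apply/funext => k; rewrite coef_fps_sum /alt_binom_gf mulr_sumr big_mkord.
apply: eq_bigr => i _.
rewrite [in RHS]exprNn -pow_halfM -(rmorph_sign (@fps_const rat)).
by rewrite coef_fps_constM mulrCA mulrA mulrC.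
Qed.

Lemma catalan_denom_alt_binom_gf d w : odd w ->
  catalan_denom d * alt_binom_gf d (w - 1) = catalan_denom (d * w).
Proof.
move=> odd_w; rewrite alt_binom_gfE subn1 prednK ?odd_gt0 //.
by rewrite mulr_sum_exprN_odd // -pow_halfM.
Qed.

Lemma map_catalan_denom w :
  map_fps polyC (catalan_denom w) =
  fps_add (fps_const 1) (pow_1m4t (w%:R / 2%:R)%:P).
Proof.
by rewrite rmorphD rmorph1 /= (map_pow_1m4t (@natS_unit_field rat)).
Qed.

Lemma map_catalan_denom_unit w :
  map_fps polyC (catalan_denom w) \is a GRing.unit.
Proof. by rewrite map_catalan_denom fps_unitE catalan_denom_unit. Qed.

Lemma catalan_gfE w :
  catalan_gf w = catalan_num w / map_fps polyC (catalan_denom w).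
Proof.
rewrite mulrAC -(rmorph_nat (@fps_const {poly rat})).
by rewrite -fps_divE ?map_catalan_denom_unit // map_catalan_denom.
Qed.

Lemma catalan_num_comp w d :
  map_fps (comp_poly (d%:R *: 'X)) (catalan_num w) = catalan_num (w * d).
Proof.
rewrite rmorphM rmorph_nat /= (map_pow_1m4t (@natS_unit_poly rat)).
rewrite rmorphM /= comp_polyC comp_polyX -mul_polyC mulrA -polyCM.
by rewrite mulrAC -natrM.
Qed.

Lemma catalan_gf_comp w d :
  map_fps (comp_poly (d%:R *: 'X)) (catalan_gf w) =
  catalan_num (w * d) / map_fps polyC (catalan_denom w).
Proof.
rewrite catalan_gfE rmorph_div ?map_catalan_denom_unit //= catalan_num_comp.
by congr (_ / _); apply/funext => k; apply: comp_polyC.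
Qed.

Lemma catalan_alt_binom_gfM w d : odd w ->
  map_fps (comp_poly (d%:R *: 'X)) (catalan_gf w)
    * map_fps polyC (alt_binom_gf d (w - 1)) =
  catalan_num (w * d) * map_fps polyC (catalan_denom (w * d))
    / map_fps polyC (catalan_denom w * catalan_denom d).
Proof.
move=> odd_w; rewrite catalan_gf_comp (mulnC w) -catalan_denom_alt_binom_gf //.
rewrite !rmorphM invrM ?map_catalan_denom_unit //.
rewrite [map_fps _ (catalan_denom d) * _]mulrC.
by rewrite !mulrA mulrK ?map_catalan_denom_unit // mulrAC.
Qed.

Lemma catalan_alt_binom_sumE n w d :
  \sum_(0 <= l < n.+1)
     ((- 4%:R) ^+ (n - l) * alt_binom_sum (n - l) d (w - 1) : rat) *:
       (catalan_poly l w \Po (d%:R *: 'X)) =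
  (map_fps (comp_poly (d%:R *: 'X)) (catalan_gf w)
     * map_fps polyC (alt_binom_gf d (w - 1))) n.
Proof.
by rewrite big_mkord; apply: eq_bigr => l _; rewrite [RHS]mulrC mul_polyC.
Qed.

Theorem theorem2 (n w1 w2 : nat)
    (hw1 : (w1 = 1 %[mod 2])%N) (hw2 : (w2 = 1 %[mod 2])%N) :
  \sum_(0 <= l < n.+1)
     ((- 4%:R) ^+ (n - l) * alt_binom_sum (n - l) w2 (w1 - 1) : rat) *:
       (catalan_poly l w1 \Po (w2%:R *: 'X)) =
  \sum_(0 <= l < n.+1)
     ((- 4%:R) ^+ (n - l) * alt_binom_sum (n - l) w1 (w2 - 1) : rat) *:
       (catalan_poly l w2 \Po (w1%:R *: 'X)).
Proof.
have odd_of_mod2 w : (w = 1 %[mod 2])%N -> odd w by rewrite !modn2; case: odd.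
rewrite !catalan_alt_binom_sumE !catalan_alt_binom_gfM ?odd_of_mod2 //.
by rewrite (mulnC w1) (mulrC (catalan_denom w1)).
Qed.
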